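(* Let $X$ be a one-dimensional sofic shift over a finite alphabet $\mathbf{A}$. Then $\sup h_{ind}(X) = h(X)$.
   Context: Shift spaces. For a finite alphabet $\mathbf{A}$, the full shift is $\mathbf{A}^{\mathbb{Z}}$ with the product topology, and the shift map $\sigma$ is $\sigma(x)_i = x_{i+1}$. A (one-dimensional) shift space over $\mathbf{A}$ is a closed, shift-invariant set $X\subseteq \mathbf{A}^{\mathbb{Z}}$, taken to be nonempty. $B_n(X)$ denotes the set of words of length $n$ over $\mathbf{A}$ that occur in some point of $X$, and $B(X)=\bigcup_{n\ge 0} B_n(X)$. Conjugacy. A sliding block code $\phi: X\to Y$ between shift spaces (possibly over different finite alphabets) is a map of the form $\phi(x)_i = F(x_{i-m}\cdots x_{i+n})$ for all $i \in \mathbb{Z}$, for some fixed integers $m,n$ with $-m\le n$ and some function $F$ on $B_{m+n+1}(X)$. $X$ and $Y$ are (topologically) conjugate, written $Y\simeq X$, if there is a bijective sliding block code between them (its inverse is then also a sliding block code). Sofic shifts. Let $G=(V,E)$ be a finite directed graph, in which each edge $e$ has an initial vertex $\mathfrak{i}(e)$ and a terminal vertex $\tau(e)$, and let $\mathcal{L}:E\to\mathbf{A}$ be a labeling. Put $X_G=\{\xi\in E^{\mathbb{Z}} : \tau(\xi_i)=\mathfrak{i}(\xi_{i+1}) \text{ for all } i\in\mathbb{Z}\}$. A shift space $X$ is sofic if for some such $G,\mathcal{L}$ we have $X=\{(\mathcal{L}(\xi_i))_{i\in\mathbb{Z}} : \xi\in X_G\}$. Topological entropy. $h(X)=\lim_{n\to\infty}\frac1n\ln|B_n(X)|$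 (the limit exists). Independence entropy. Let $\hat{\mathbf{A}}$ be the set of nonempty subsets of $\mathbf{A}$. For a finite word $\hat w$ over $\hat{\mathbf{A}}$, let $\Phi(\hat w)$ be the set of words $w$ over $\mathbf{A}$ with $|w|=|\hat w|$ and $w_i\in\hat w_i$ for all $i$. For $\hat x\in\hat{\mathbf{A}}^{\mathbb{Z}}$, let $\Phi(\hat x)=\{x\in\mathbf{A}^{\mathbb{Z}} : x_i\in\hat x_i \text{ for all } i\in\mathbb{Z}\}$. The multi-choice shift space of $X$ is $\hat X=\{\hat x\in\hat{\mathbf{A}}^{\mathbb{Z}} : \Phi(\hat x)\subseteq X\}$. The independence entropy of $X$ is $$h_{ind}(X)=\lim_{m\to\infty}\frac{\max\{\ln|\Phi(\hat w)| : \hat w\in B_m(\hat X)\}}{m}$$ (the limit exists). Supremum independence entropy. $\sup h_{ind}(X)=\sup\{h_{ind}(Y) : Y\simeq X\}$, the supremum being over all shift spaces $Y$ (over arbitrary finite alphabets) conjugate to $X$. *)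

(* Defs.v *)
From mathcomp Require Import all_boot all_order all_algebra.
From mathcomp Require Import all_classical all_reals all_analysis.

Set Implicit Arguments.
Unset Strict Implicit.
Unset Printing Implicit Defensive.

Import Order.TTheory GRing.Theory Num.Theory.
Import numFieldNormedType.Exports.

Local Open Scope classical_set_scope.
Local Open Scope ring_scope.

Notation full_shift A := (prod_topology (fun _ : int => discrete_topology A)).

Definition shift (A : finType) (x : int -> A) : int -> A := fun i => x (i + 1).

(* Shift-invariant means equal to, not just containing, its image by the shift. *)
Definition shift_space (A : finType) (X : set (int -> A)) : Prop :=
  [/\ X !=set0, closed (X : set (full_shift A)) & @shift A @` X = X].

Definition window (A : finType) (x : int -> A) (i : int) (n : nat) :
    n.-tuple A :=
  [tuple x (i + k%:Z) | k < n].

Definition words (A : finType) (X : set (int -> A)) (n : nat) :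
    {set n.-tuple A} :=
  [set w : n.-tuple A | `[< exists2 x, X x & exists i, window x i n = w >]]%SET.

(* The local rule [F] is total on words of length m + n + 1; only its values on
   words of [X] matter.  Since - m <= n, the absolute value is m + n + 1. *)
Definition sliding_block_code (A B : finType) (X : set (int -> A))
    (phi : (int -> A) -> (int -> B)) : Prop :=
  exists (m n : int) (F : (absz (m + n + 1)).-tuple A -> B),
    - m <= n /\
    forall x, X x -> forall i, phi x i = F (window x (i - m) (absz (m + n + 1))).

Definition conjugate (A B : finType) (X : set (int -> A))
    (Y : set (int -> B)) : Prop :=
  exists phi : (int -> A) -> (int -> B),
    sliding_block_code X phi /\ set_bij X Y phi.

Definition edge_shift (V E : finType) (ini ter : E -> V) : set (int -> E) :=
  [set xi | forall i : int, ter (xi i) = ini (xi (i + 1))].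

Definition sofic (A : finType) (X : set (int -> A)) : Prop :=
  shift_space X /\
  exists (V E : finType) (ini ter : E -> V) (L : E -> A),
    X = (fun xi : int -> E => L \o xi) @` edge_shift ini ter.

Definition entropy (R : realType) (A : finType) (X : set (int -> A)) : R :=
  limn (fun n : nat => ln (#|words X n|%:R : R) / n%:R).

Definition hat (A : finType) : finType := {S : {set A} | S != finset.set0}.

Definition choice_words (A : finType) (n : nat) (w : n.-tuple (hat A)) :
    {set n.-tuple A} :=
  [set u : n.-tuple A | [forall k, tnth u k \in val (tnth w k)]]%SET.

Definition choice_points (A : finType) (hx : int -> hat A) : set (int -> A) :=
  [set x | forall i, x i \in val (hx i)].

Definition multi_choice (A : finType) (X : set (int -> A)) :
    set (int -> hat A) :=
  [set hx | choice_points hx `<=` X].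

(* The default value 0 of the maximum is harmless: all the logarithms are
   nonnegative, because [choice_words w] is never empty. *)
Definition ind_entropy (R : realType) (A : finType) (X : set (int -> A)) : R :=
  limn (fun m : nat =>
    (\big[Num.max/0]_(w in words (multi_choice X) m)
       ln (#|choice_words w|%:R : R)) / m%:R).

Definition sup_ind_entropy (R : realType) (A : finType) (X : set (int -> A)) :
    \bar R :=
  ereal_sup [set r : \bar R | exists (B : finType) (Y : set (int -> B)),
    [/\ shift_space Y, conjugate X Y & r = (ind_entropy R Y)%:E]].

(* Main.v *)
Require Import Defs.
From mathcomp Require Import all_boot all_order all_algebra.
From mathcomp Require Import all_classical all_reals all_analysis.
From mathcomp Require Import zify ring lra.

Set Implicit Arguments.
Unset Strict Implicit.
Unset Printing Implicit Defensive.

Import Order.TTheory GRing.Theory Num.Theory.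
Import numFieldNormedType.Exports.

Local Open Scope classical_set_scope.
Local Open Scope ring_scope.

(** The upper bound is soft.  If [Y] is conjugate to [X], the choices of a
    multi-choice word of length m are words of [Y], and a block code maps words
    of [X] of length m + c onto the words of [Y] of length m.  By Fekete's lemma
    both entropies are limits of u_m / m for subadditive u, and an independence
    entropy is at most each of its terms, so the independence entropy of [Y] is
    at most the entropy of [X] ([ind_entropy_le_factor]).

    For the lower bound, let 0 <= r < h(X) and fix a presentation of [X] by a
    labelled graph.  Cutting a path at its last visit of the vertex it has just
    entered, then again in the graph without that vertex, writes any word as
    boundedly many letters and labels of loops.  Hence, for some vertex s and
    arbitrarily large n, the set S of labels of loops of length n at s has nearly
    exp(n h(X)) elements ([loops_growth]).  All concatenations of words of S lie
    in [X].

    Choose a in S, remove from S the at most n rotations of a to get W, choose b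
    in W, and call aab the marker.  The code [recode] rewrites, behind each
    marker, a stretch of l n letters: these letters are erased, and every n-th
    position carries the word of length n that starts there.  Nothing is lost,
    even if stretches overlap, so [recode] is injective on all sequences
    ([recode_inj]) and its image of [X] is a shift space conjugate to [X].

    In a concatenation of blocks  a a b w_1 .. w_l  repeated periodically, with
    all w_i in W, the marker occurs only where expected ([marker_concat]): an
    occurrence contains an aligned block that is a rotation of a, hence one of
    the blocks a, and two markers at distance at most n coincide
    ([marker_sep]).  So each w_i is recoded at a single position, and all other
    positions do not depend on the w_i: the choices of the w_i in W are
    independent, and the independence entropy of the image is at least
    l ln|W| / ((l + 3) n), which is at least r for n and l large. *)

(** * Fekete's lemma *)

(** A nonnegative subadditive sequence has a mean, equal to the infimum of
    u_n / n. *)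
Lemma fekete (R : realType) (u : nat -> R) :
  (forall n, 0 <= u n) -> (forall m n, u (m + n)%N <= u m + u n) ->
  cvgn (fun n => u n / n%:R) /\
  forall n, (0 < n)%N -> limn (fun n => u n / n%:R) <= u n / n%:R.
Proof.
move=> u_ge0 u_sub.
pose S := [set u n / n%:R | n in [set n | (0 < n)%N]].
have S_lb : lbound S 0 by move=> _ [n _ <-]; rewrite divr_ge0.
have S_inf : has_inf S by split; [exists (u 1%N / 1%:R), 1%N | exists 0].
have inf_le n : (0 < n)%N -> inf S <= u n / n%:R.
  by move=> n0; apply: ge_inf; [exists 0 | exists n].
have u_mul n q : u (q * n)%N <= q%:R * u n + u 0%N.
  elim: q => [|q IH]; first by rewrite mul0n mul0r add0r.
  rewrite mulSn (le_trans (u_sub _ _))// -natr1 mulrDl mul1r; lra.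
suff u_cvg : (fun n => u n / n%:R) @ \oo --> inf S.
  split; first by apply/cvg_ex; exists (inf S).
  by move=> n n0; rewrite (cvg_lim _ u_cvg)// inf_le.
apply/cvgrPdist_le => e e0.
have [_ [n n0 <-] un] := inf_adherent (divr_gt0 e0 (ltr0n _ 2)) S_inf.
pose M := u 0%N + \sum_(r < n) u r.
have M_ge0 : 0 <= M by rewrite addr_ge0// sumr_ge0.
near=> m.
have m0 : (0 < m)%N by near: m; exists 1%N.
have m0R : (0 : R) < m%:R by rewrite ltr0n.
have n0R : (0 : R) < n%:R by rewrite ltr0n.
have Mm : M <= e / 2 * m%:R.
  rewrite -ler_pdivrMl ?divr_gt0// mulrC.
  by near: m; exact: nbhs_infty_ger.
(* Divide m by n with remainder: u_m <= (m / n) u_n + M, and M <= e m / 2. *)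
rewrite ler_distlC; apply/andP; split.
  by apply: (@le_trans _ _ (inf S)); [rewrite gerBl ltW | exact: inf_le].
rewrite ler_pdivrMr// mulrDl.
have um : u m <= (m %/ n)%:R * u n + M.
  rewrite {1}(divn_eq m n) (le_trans (u_sub _ _))//.
  apply: (le_trans (lerD (u_mul _ _) (lexx _))).
  rewrite /M -!addrA !lerD2l (bigD1 (Ordinal (ltn_pmod m n0)))//=.
  by rewrite lerDl sumr_ge0.
have q_le : (m %/ n)%:R * u n <= u n / n%:R * m%:R.
  rewrite mulrAC ler_pdivlMr// mulrAC [u n * _]mulrC ler_wpM2r// -natrM ler_nat.
  exact: leq_trunc_div.
have u_le : u n / n%:R * m%:R <= (inf S + e / 2) * m%:R by rewrite ler_pM2r// ltW.
nra.
Unshelve. all: by end_near. Qed.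

(** * Words, entropy and independence entropy *)

Lemma wordsP (A : finType) (X : set (int -> A)) n (w : n.-tuple A) :
  reflect (exists2 x, X x & exists i, window x i n = w) (w \in words X n).
Proof. by rewrite inE; exact: asboolP. Qed.

Lemma tnth_window (A : finType) (x : int -> A) i n (k : 'I_n) :
  tnth (window x i n) k = x (i + k%:Z).
Proof. by rewrite tnth_mktuple. Qed.

(** The first m and the last n letters of a word of length m + n. *)
Definition ltuple (A : Type) m n (w : (m + n).-tuple A) : m.-tuple A :=
  [tuple tnth w (lshift n k) | k < m].

Definition rtuple (A : Type) m n (w : (m + n).-tuple A) : n.-tuple A :=
  [tuple tnth w (rshift m k) | k < n].

Lemma lrtuple_inj (A : Type) m n :
  injective (fun w : (m + n).-tuple A => (ltuple w, rtuple w)).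
Proof.
move=> v w vw; have [lvw rvw] := (congr1 fst vw, congr1 snd vw).
apply: eq_from_tnth => k.
rewrite -(splitK k); case: (fintype.split k) => j /=.
  by have := congr1 (fun t => tnth t j) lvw; rewrite !tnth_mktuple.
by have := congr1 (fun t => tnth t j) rvw; rewrite !tnth_mktuple.
Qed.

Lemma ltuple_words (A : finType) (X : set (int -> A)) m n w :
  w \in words X (m + n) -> ltuple w \in words X m.
Proof.
move=> /wordsP[x Xx [i <-]]; apply/wordsP; exists x => //; exists i.
by apply: eq_from_tnth => k; rewrite !tnth_mktuple.
Qed.

Lemma rtuple_words (A : finType) (X : set (int -> A)) m n w :
  w \in words X (m + n) -> rtuple w \in words X n.
Proof.
move=> /wordsP[x Xx [i <-]]; apply/wordsP; exists x => //; exists (i + m%:Z).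
by apply: eq_from_tnth => k; rewrite !tnth_mktuple /= PoszD addrA.
Qed.

Lemma card_words_add (A : finType) (X : set (int -> A)) m n :
  (#|words X (m + n)| <= #|words X m| * #|words X n|)%N.
Proof.
rewrite -cardsX -(card_imset _ (@lrtuple_inj A m n)) subset_leq_card//.
apply/fintype.subsetP => _ /imsetP[w ww ->].
by rewrite inE/= ltuple_words// rtuple_words.
Qed.

Lemma card_words_gt0 (A : finType) (X : set (int -> A)) n :
  X !=set0 -> (0 < #|words X n|)%N.
Proof.
move=> [x Xx]; apply/card_gt0P; exists (window x 0 n).
by apply/wordsP; exists x => //; exists 0.
Qed.

Lemma card_choice_words (A : finType) n (w : n.-tuple (hat A)) :
  #|choice_words w| = (\prod_(k < n) #|val (tnth w k)|)%N.
Proof.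
pose F (k : 'I_n) := mem (val (tnth w k)).
transitivity #|finfun.family F|; last by rewrite card_family foldrE big_map big_enum.
pose g (u : n.-tuple A) := [ffun k => tnth u k].
have g_inj : injective g.
  move=> u v /ffunP uv; apply: eq_from_tnth => k.
  by have := uv k; rewrite !ffunE.
rewrite -(card_imset _ g_inj); apply: eq_card => f.
apply/imsetP/familyP => [[u + ->] k|fF].
  by rewrite inE => /forallP/(_ k); rewrite ffunE.
exists [tuple f k | k < n]; last by apply/ffunP => k; rewrite ffunE tnth_mktuple.
by rewrite inE; apply/forallP => k; rewrite tnth_mktuple; exact: fF.
Qed.

Lemma card_hat_gt0 (A : finType) (S : hat A) : (0 < #|val S|)%N.
Proof. by rewrite card_gt0; case: S. Qed.

Lemma ln_prod_nat (R : realType) n (c : 'I_n -> nat) :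
  (forall k, (0 < c k)%N) ->
  ln ((\prod_(k < n) c k)%N%:R : R) = \sum_(k < n) ln (c k)%:R.
Proof.
elim: n c => [|n IH] c c0; first by rewrite !big_ord0 ln1.
rewrite !big_ord_recl natrM lnM ?posrE ?ltr0n// ?IH//.
by rewrite prodn_gt0.
Qed.

Lemma ln_card_choice_words (R : realType) (A : finType) n
    (w : n.-tuple (hat A)) :
  ln (#|choice_words w|%:R : R) = \sum_(k < n) ln #|val (tnth w k)|%:R.
Proof. by rewrite card_choice_words ln_prod_nat// => k; exact: card_hat_gt0. Qed.

Lemma ln_nat_ge0 (R : realType) n : 0 <= ln (n%:R : R).
Proof. by case: n => [|n]; [rewrite ln0 | rewrite ln_ge0// ler1n]. Qed.

(** The logarithm of the largest number of choices offered by a word of length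
    m of the multi-choice shift. *)
Definition max_choice (R : realType) (A : finType) (X : set (int -> A)) m : R :=
  \big[Num.max/0]_(w in words (multi_choice X) m) ln (#|choice_words w|%:R : R).

Lemma max_choice_ge0 (R : realType) (A : finType) (X : set (int -> A)) m :
  0 <= max_choice R X m.
Proof. by rewrite bigmax_ge_id. Qed.

Lemma max_choice_add (R : realType) (A : finType) (X : set (int -> A)) m n :
  max_choice R X (m + n) <= max_choice R X m + max_choice R X n.
Proof.
apply: bigmax_le => [|w ww]; first by rewrite addr_ge0 ?max_choice_ge0.
rewrite ln_card_choice_words big_split_ord/=; apply: lerD.
- apply: le_trans (le_bigmax_cond _ _ (ltuple_words ww)).
  by rewrite ln_card_choice_words ler_sum// => k _; rewrite tnth_mktuple.
- apply: le_trans (le_bigmax_cond _ _ (rtuple_words ww)).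
  by rewrite ln_card_choice_words ler_sum// => k _; rewrite tnth_mktuple.
Qed.

Lemma ind_entropyP (R : realType) (A : finType) (X : set (int -> A)) :
  cvgn (fun m => max_choice R X m / m%:R) /\
  forall m, (0 < m)%N -> ind_entropy R X <= max_choice R X m / m%:R.
Proof. by apply: fekete => *; [exact: max_choice_ge0 | exact: max_choice_add]. Qed.

Lemma ind_entropy_ge0 (R : realType) (A : finType) (X : set (int -> A)) :
  0 <= ind_entropy R X.
Proof.
apply: limr_ge; first exact: (ind_entropyP R X).1.
by apply: nearW => m; rewrite divr_ge0// max_choice_ge0.
Qed.

Lemma entropyP (R : realType) (A : finType) (X : set (int -> A)) :
  X !=set0 ->
  cvgn (fun n => ln (#|words X n|%:R : R) / n%:R) /\
  forall n, (0 < n)%N -> entropy R X <= ln #|words X n|%:R / n%:R.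
Proof.
move=> X0; apply: fekete => [n|m n]; first exact: ln_nat_ge0.
rewrite -lnM ?posrE ?ltr0n ?card_words_gt0// -natrM.
rewrite ler_ln ?posrE ?ltr0n ?muln_gt0 ?card_words_gt0// ler_nat.
exact: card_words_add.
Qed.

Lemma le_max_choice (R : realType) (A : finType) (X : set (int -> A)) m :
  max_choice R X m <= ln #|words X m|%:R.
Proof.
apply: bigmax_le => [|w /wordsP[hx hX [i iw]]]; first exact: ln_nat_ge0.
(* Every choice [u] of the word [w] is completed to a point by arbitrary choices
   outside the window. *)
have cw_sub : choice_words w \subset words X m.
  apply/fintype.subsetP => u; rewrite inE => /forallP uw; apply/wordsP.
  pose k0 j := `|j - i|%N.
  have hx_ex j : exists a, a \in val (hx j).
    by have /set0Pn := valP (hx j).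
  pose f j := xchoose (hx_ex j).
  pose x (j : int) := if (i <= j) && (k0 j < m)%N then nth (f j) u (k0 j) else f j.
  exists x.
    apply: hX => j; rewrite /x.
    case: ifP => [/andP[ij jm]|_]; last exact: xchooseP.
    have := uw (Ordinal jm); rewrite (tnth_nth (f j)) -iw tnth_window/=.
    by have -> : i + (k0 j)%:Z = j by rewrite /k0; lia.
  exists i; apply: eq_from_tnth => k; rewrite tnth_window /x.
  rewrite lerDl /= /k0 addrC addKr absz_nat ltn_ord.
  by rewrite (tnth_nth (f (i + k))).
rewrite ler_ln ?posrE ?ltr0n ?ler_nat; first exact: subset_leq_card.
  by rewrite card_choice_words prodn_gt0// => k; exact: card_hat_gt0.
apply: (leq_trans _ (subset_leq_card cw_sub)).
by rewrite card_choice_words prodn_gt0// => k; exact: card_hat_gt0.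
Qed.

(** The letters of a word of length k of the factor are determined by a word
    of length k + c of [X]. *)
Lemma card_words_factor (A B : finType) (X : set (int -> A))
    (Y : set (int -> B)) phi :
  X !=set0 -> sliding_block_code X phi -> Y `<=` phi @` X ->
  exists c, forall k, (#|words Y k| <= #|words X (k + c)|)%N.
Proof.
move=> [x0 _] [m [n [F [_ phiF]]]] YX; set l := absz (m + n + 1)%R in F phiF.
exists l => k; pose a0 := x0 0.
pose f (w : (k + l).-tuple A) : k.-tuple B :=
  [tuple F [tuple nth a0 w (j + t) | t < l] | j < k].
apply: leq_trans (leq_imset_card f _); apply: subset_leq_card.
apply/fintype.subsetP => _ /wordsP[y /YX[x Xx <-] [i <-]].
apply/imsetP; exists (window x (i - m) (k + l)).
  by apply/wordsP; exists x => //; exists (i - m).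
apply: eq_from_tnth => j; rewrite tnth_window tnth_mktuple phiF//.
congr F; apply: eq_from_tnth => t; rewrite tnth_window tnth_mktuple.
have jt : (j + t < k + l)%N by rewrite -addnS leq_add// ltnW.
rewrite -(tnth_nth a0 _ (Ordinal jt)) tnth_window/=; congr x; lia.
Qed.

Lemma ind_entropy_le_factor (R : realType) (A B : finType)
    (X : set (int -> A)) (Y : set (int -> B)) :
  X !=set0 -> Y !=set0 -> conjugate X Y -> ind_entropy R Y <= entropy R X.
Proof.
move=> X0 Y0 [phi [phi_code [_ _ phi_surj]]].
have [c YX] := card_words_factor X0 phi_code phi_surj.
have [X_cvg _] := entropyP R X0.
set u := fun n => ln (#|words X n|%:R : R) / n%:R in X_cvg.
set K := ln (#|words X c|%:R : R).
have v_cvg : (fun n => u n + K * n%:R^-1) @ \oo --> entropy R X + K * 0.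
  apply: cvgD; first exact: X_cvg.
  apply: cvgMr; apply/cvgrPdist_le => e e0.
  near=> n.
  have n0 : (0 : R) < n%:R by rewrite ltr0n; near: n; exists 1%N.
  rewrite sub0r normrN ger0_norm ?invr_ge0// invf_ple ?posrE//.
  by near: n; exact: nbhs_infty_ger.
rewrite mulr0 addr0 in v_cvg; rewrite -(cvg_lim _ v_cvg)//.
apply: limr_ge; first by apply/cvg_ex; exists (entropy R X).
near=> n.
have n0 : (0 < n)%N by near: n; exists 1%N.
apply: le_trans ((ind_entropyP R Y).2 n n0) _.
rewrite /u -mulrDl ler_pM2r ?invr_gt0 ?ltr0n//.
apply: le_trans (le_max_choice _ _ _) _.
rewrite -lnM ?posrE ?ltr0n ?card_words_gt0// -natrM.
rewrite ler_ln ?posrE ?ltr0n ?muln_gt0 ?card_words_gt0// ler_nat.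
exact: leq_trans (YX n) (card_words_add _ _ _).
Unshelve. all: by end_near. Qed.

(** * Sliding block codes on full shifts *)

(** The shift-commuting map whose coordinate 0 is [g]. *)
Definition code_of (A B : Type) (g : (int -> A) -> B) (x : int -> A) : int -> B :=
  fun i => g (fun k => x (i + k)).

(** [g] depends only on the coordinates of absolute value at most [r]. *)
Definition local_rule (A B : Type) (g : (int -> A) -> B) (r : nat) :=
  forall x y, (forall k : int, (`|k|%N <= r)%N -> x k = y k) -> g x = g y.

Lemma code_of_sliding (A B : finType) (X : set (int -> A))
    (g : (int -> A) -> B) r :
  X !=set0 -> local_rule g r -> sliding_block_code X (code_of g).
Proof.
move=> [x0 _] g_loc; exists r%:Z, r%:Z.
exists (fun w => g (fun k => nth (x0 0) w (absz (k + r%:Z)%R))); split; first lia.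
move=> x _ i; apply: g_loc => k kr.
have lt_kr : (absz (k + r%:Z)%R < absz (r%:Z + r%:Z + 1)%R)%N by lia.
by rewrite -(tnth_nth (x0 0) _ (Ordinal lt_kr)) tnth_window/=; congr x; lia.
Qed.

Lemma near_coord (A : finType) (x : full_shift A) (i : int) :
  \forall y \near x, y i = x i.
Proof.
have /(_ _ (discrete_set1 (x i))) := @proj_continuous int (fun _ => discrete_topology A) i x.
by [].
Qed.

Lemma continuous_prod_topology (S : topologicalType) (I : Type)
    (T : I -> topologicalType) (f : S -> prod_topology T) :
  (forall x i U, open U -> U (f x i) -> \forall y \near x, U (f y i)) ->
  continuous f.
Proof.
move=> f_near x; apply/cvg_sup => i U [_ [[V oV <-] /= Vx]] /filterS; apply.
exact: f_near.
Qed.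

Lemma code_of_continuous (A B : finType) (g : (int -> A) -> B) r :
  local_rule g r -> continuous (code_of g : full_shift A -> full_shift B).
Proof.
move=> g_loc; apply: (@continuous_prod_topology (full_shift A) int
  (fun _ => discrete_topology B)) => x i U _ Ux.
pose P (k : 'I_(r + r).+1) : set (full_shift A) :=
  [set y | y (i + (k%:Z - r%:Z)) = x (i + (k%:Z - r%:Z))].
have : \forall y \near x, forall k, P k y.
  apply: (@filter_forall _ _ P _ (nbhs_filter x)) => k.
  exact: near_coord.
apply: (@filterS _ _ (nbhs_filter x)) => y yx.
suff -> : code_of g y i = code_of g x i by [].
apply: g_loc => k kr.
have kr' : (absz (k + r%:Z)%R < (r + r).+1)%N by lia.
have := yx (Ordinal kr'); rewrite /P /=.
by have -> : i + ((absz (k + r%:Z)%R)%:Z - r%:Z) = i + k by lia.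
Qed.

Lemma full_shift_compact (A : finType) : compact [set: full_shift A].
Proof.
have := @tychonoff int (fun _ => discrete_topology A) (fun _ => setT).
rewrite (_ : [set f | _] = setT); last by apply/seteqP; split.
by apply=> i; apply: finite_compact; exact: finite_finset.
Qed.

(** The image is closed because the full shift is compact and Hausdorff. *)
Lemma shift_space_code (A B : finType) (X : set (int -> A))
    (g : (int -> A) -> B) r :
  local_rule g r -> shift_space X -> shift_space (code_of g @` X).
Proof.
move=> g_loc [[x0 Xx0] X_cl X_sh]; split.
- by exists (code_of g x0), x0.
- apply: (@compact_closed (full_shift B)).
    by apply: hausdorff_product => i; exact: discrete_hausdorff.
  apply: (@continuous_compact (full_shift A) (full_shift B)).
    by apply: continuous_subspaceT; exact: code_of_continuous g_loc.
  by apply: subclosed_compact X_cl (@full_shift_compact A) _.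
- have sh_code x : Defs.shift (code_of g x) = code_of g (Defs.shift x).
    apply/funext => i; congr g; apply/funext => k; rewrite /Defs.shift; congr x; lia.
  apply/seteqP; split => [_ [_ [x Xx <-] <-]|_ [x Xx <-]].
    by rewrite sh_code; exists (Defs.shift x) => //; rewrite -X_sh; exists x.
  move: Xx; rewrite -{1}X_sh => -[y Xy <-].
  by rewrite -sh_code; exists (code_of g y) => //; exists y.
Qed.

(** * Loops in a presentation carry the entropy *)

Section SoficPresentation.
Variables (A V E : finType) (ini ter : E -> V) (L : E -> A).

(** [walk s p t]: the edges [p] form a path from [s] to [t]. *)
Fixpoint walk (s : V) (p : seq E) (t : V) : bool :=
  if p is e :: p' then (ini e == s) && walk (ter e) p' t else s == t.

Lemma walk_last_visit s p t : walk s p t ->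
  exists p1 p2, [/\ p = p1 ++ p2, walk s p1 s, walk s p2 t &
    all (fun e => ter e != s) p2].
Proof.
suff cut r : walk r p t ->
    (exists p1 p2, [/\ p = p1 ++ p2, walk r p1 s, walk s p2 t &
      all (fun e => ter e != s) p2]) \/ r != s /\ all (fun e => ter e != s) p.
  move=> w; case: (cut s w) => [//|[]]; by rewrite eqxx.
elim: p r => [|e p IH] r /=.
  move=> /eqP ->; have [->|ts] := eqVneq t s; last by right.
  by left; exists [::], [::]; rewrite /= eqxx.
move=> /andP[er wp].
have [[p1 [p2 [-> wp1 wp2 p2s]]]|[es ps]] := IH _ wp.
  by left; exists (e :: p1), p2; split => //=; rewrite er.
have [rs|rs] := eqVneq r s; last by right; rewrite es ps.
by left; exists [::], (e :: p); rewrite /= rs eqxx es ps -rs er.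
Qed.

(** The labels of the closed paths of length n at [s]. *)
Definition loops (s : V) n : {set n.-tuple A} :=
  [set w : n.-tuple A | `[< exists2 p, walk s p s & map L p = w >]]%SET.

(** A list containing all labels of paths of length n that enter at most u
    distinct vertices.  Such a path is empty, or is an edge with label c into a
    vertex s, followed by a loop of length k at s, and by a path that never
    enters s again.  Words that are no such labels are harmless. *)
Fixpoint cover (u n : nat) : seq (seq A) :=
  if u is u'.+1 then
    [::] :: flatten [seq flatten [seq [seq c :: vw | c <- enum A,
        vw <- [seq val v ++ w | v <- enum (loops s k), w <- cover u' (n - k.+1)%N]]
      | k <- iota 0 n] | s <- enum V]
  else [:: [::]].

Lemma mem_cover u (U : {set V}) n s p t :
  (#|U| <= u)%N -> walk s p t -> all (fun e => ter e \in U) p -> size p = n ->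
  map L p \in cover u n.
Proof.
elim: u U n s p => [|u IH] U n s [|e p] //= Uu.
- move: Uu; rewrite leqn0 cards_eq0 => /eqP ->.
  by rewrite !inE.
- move=> /andP[_ /walk_last_visit[p1 [p2 [-> wp1 wp2 p2s]]]] /andP[eU].
  rewrite all_cat => /andP[_ p2U] pn; rewrite inE; apply/orP; right.
  have p1n : (size p1 < n)%N by rewrite -pn size_cat ltnS leq_addr.
  apply/flatten_mapP; exists (ter e); first by rewrite mem_enum.
  apply/flatten_mapP; exists (size p1); first by rewrite mem_iota.
  apply: allpairs_f; first by rewrite mem_enum.
  rewrite map_cat; apply/allpairsP; exists (map_tuple L (in_tuple p1), map L p2).
  split => //=.
    by rewrite mem_enum inE; apply/asboolP; exists p1.
  (* After its last visit of [ter e] the path enters one vertex less. *)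
  apply: (IH (U :\ ter e)%SET _ (ter e)) => //.
  - by rewrite -ltnS (leq_trans _ Uu)// [X in (_ < X)%N](cardsD1 (ter e)) eU.
  - apply/allP => f fp2; rewrite in_setD1 (allP p2s) // (allP p2U) //.
  - by rewrite -pn size_cat; lia.
Qed.

(** If the numbers of loops grow at most like lam^n, so do the covers, up to a
    polynomial factor. *)
Lemma size_cover (R : realType) (lam C : R) u n :
  (0 < #|V|)%N -> (0 < #|A|)%N -> 1 <= lam -> 1 <= C ->
  (forall s k, #|loops s k|%:R <= C * lam ^+ k) ->
  (size (cover u n))%:R <= (#|V|%:R * #|A|%:R * C * n.+1%:R) ^+ u * lam ^+ n.
Proof.
move=> V0 A0 lam1 C1 loopsC.
set D := #|V|%:R * #|A|%:R * C.
have D1 : 1 <= D by rewrite /D -natrM mulr_ege1// ler1n muln_gt0 V0.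
elim: u n => [|u IH] n; first by rewrite expr0 mul1r exprn_ege1.
rewrite /= size_flatten /shape -map_comp sumnE big_map -natr1 natr_sum.
have DT m : 1 <= D * m.+1%:R by rewrite mulr_ege1// ler1n.
set T := (D * n.+1%:R) ^+ u.
have T1 : 1 <= T by rewrite exprn_ege1.
have lamn : 1 <= lam ^+ n by rewrite exprn_ege1.
have sum_le : \sum_(s <- enum V) (((size \o (fun s : V => flatten [seq
      [seq c :: vw | c <- enum A, vw <- [seq val v ++ w |
         v <- enum (loops s k), w <- cover u (n - k.+1)%N]] | k <- iota 0 n])) s)%:R : R)
    <= \sum_(s <- enum V) (n%:R * (#|A|%:R * C * T * lam ^+ n)).
  apply: ler_sum => s _ /=.
  rewrite size_flatten /shape -map_comp sumnE big_map natr_sum.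
  apply: (@le_trans _ _ (\sum_(k <- iota 0 n) (#|A|%:R * C * T * lam ^+ n))); last first.
    by rewrite big_const_seq count_predT size_iota iter_addr_0 -[leLHS]mulr_natl.
  rewrite big_seq [leRHS]big_seq; apply: ler_sum => k; rewrite mem_iota add0n /= => kn.
  rewrite !size_allpairs -!cardE !natrM -!mulrA ler_wpM2l//.
  apply: (@le_trans _ _ ((C * lam ^+ k) * (T * lam ^+ (n - k.+1)%N))).
    rewrite ler_pM ?loopsC//; apply: le_trans (IH _) _.
    rewrite ler_wpM2r ?exprn_ge0 ?(le_trans ler01 lam1)//.
    apply: lerXn2r; rewrite ?nnegrE ?(le_trans ler01 (DT _))//.
    rewrite ler_wpM2l ?(le_trans ler01 D1)//.
    by rewrite ler_nat; lia.
  rewrite mulrACA -mulrA -exprD; do 2 rewrite ler_wpM2l ?(le_trans ler01 C1) ?(le_trans ler01 T1)//.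
  by rewrite ler_weXn2l//; lia.
apply: (le_trans (lerD sum_le (lexx 1))).
rewrite big_const_seq count_predT -cardE iter_addr_0 -[X in X + 1]mulr_natl.
rewrite exprS -/T -natr1.
have -> : #|V|%:R * (n%:R * (#|A|%:R * C * T * lam ^+ n)) = D * n%:R * T * lam ^+ n.
  by rewrite /D; ring.
have -> : D * (n%:R + 1) * T * lam ^+ n = D * n%:R * T * lam ^+ n + D * T * lam ^+ n by ring.
by rewrite lerD2l; do 2 rewrite mulr_ege1//.
Qed.

Lemma words_cover n (w : n.-tuple A) :
  w \in words ((fun xi : int -> E => L \o xi) @` edge_shift ini ter) n ->
  val w \in cover #|V| n.
Proof.
move=> /wordsP[_ [xi xiE <-] [i <-]].
have walk_xi m j : walk (ini (xi j)) [seq xi (j + k%:Z) | k <- iota 0 m]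
    (ini (xi (j + m%:Z))).
  elim: m j => [|m IH] j /=; first by rewrite addr0.
  rewrite addr0 eqxx xiE /=.
  have -> : j + m.+1%:Z = (j + 1) + m%:Z by lia.
  rewrite -[1%N]addn0 iotaDl -map_comp.
  rewrite (_ : [seq _ | _ <- _] = [seq xi (j + 1 + k%:Z) | k <- iota 0 m]) ?IH//.
  by apply: eq_map => k /=; congr xi; lia.
have -> : val (window (L \o xi) i n) = map L [seq xi (i + k%:Z) | k <- iota 0 n].
  by rewrite /= -val_enum_ord -!map_comp; apply: eq_map.
apply: (mem_cover (U := [set: V]%SET) _ (walk_xi n i)).
- by rewrite cardsT.
- by apply/allP => e _; rewrite inE.
- by rewrite size_map size_iota.
Qed.

End SoficPresentation.

Lemma poly_lt_expR (R : realType) (th D : R) v :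
  0 < th -> 1 <= D -> exists2 n, (0 < n)%N & (D * n.+1%:R) ^+ v < expR (n%:R * th).
Proof.
move=> th0 D1; (* Use expR y >= 1 + y at y = n th / (v + 1), raised to the power v + 1. *)
pose c := Num.min 1 (th / v.+1%:R).
have c0 : 0 < c by rewrite lt_min ltr01 divr_gt0.
have cth : c <= th / v.+1%:R by rewrite ge_min lexx orbT.
have c1 : c <= 1 by rewrite ge_min lexx.
pose n := (Num.truncn (D ^+ v / c ^+ v.+1)).+1.
exists n => //.
have Dn : D ^+ v < c ^+ v.+1 * n.+1%:R.
  rewrite mulrC -ltr_pdivrMr ?exprn_gt0//; apply: lt_trans (truncnS_gt _) _.
  by rewrite ltr_nat.
have n1 : c * n.+1%:R <= 1 + n%:R * (th / v.+1%:R).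
  by rewrite -natr1 mulrDr mulr1 addrC lerD// mulrC ler_wpM2l.
have -> : n%:R * th = v.+1%:R * (n%:R * (th / v.+1%:R)).
  by rewrite [RHS]mulrCA [_ * (th / _)]mulrC divfK ?pnatr_eq0.
rewrite expRM_natl; apply: (@lt_le_trans _ _ ((c * n.+1%:R) ^+ v.+1)).
  by rewrite !exprMn [n.+1%:R ^+ v.+1]exprS mulrA ltr_pM2r.
apply: lerXn2r; rewrite ?nnegrE ?expR_ge0 ?mulr_ge0 ?(ltW c0)//.
by apply: le_trans n1 _; exact: expR_ge1Dx.
Qed.

(** Otherwise [size_cover] would bound the number of words of length n by a
    polynomial times lam^n, against exp(n h(X)) <= |words X n|. *)
Lemma loops_growth (R : realType) (A V E : finType) (ini ter : E -> V)
    (L : E -> A) (lam : R) n0 :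
  let X := (fun xi : int -> E => L \o xi) @` edge_shift ini ter in
  X !=set0 -> 1 <= lam -> ln lam < entropy R X ->
  exists n s, (n0 <= n)%N /\ lam ^+ n < #|loops ini ter L s n|%:R.
Proof.
move=> X X0 lam1 lamX; apply: contrapT => no_loops.
have [_ [xi _ _]] := X0.
have V0 : (0 < #|V|)%N by apply/card_gt0P; exists (ini (xi 0)).
have A0 : (0 < #|A|)%N by apply/card_gt0P; exists (L (xi 0)).
(* C absorbs the finitely many lengths below n0. *)
pose C : R := #|A|%:R ^+ n0.
have C1 : 1 <= C by rewrite exprn_ege1// ler1n.
have loopsC s k : #|loops ini ter L s k|%:R <= C * lam ^+ k.
  have [kn|nk] := ltnP k n0.
    apply: (@le_trans _ _ (#|A|%:R ^+ k)).
      by rewrite -natrX ler_nat -card_tuple max_card.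
    apply: (@le_trans _ _ C); first by rewrite ler_weXn2l ?ler1n// ltnW.
    by rewrite ler_peMr ?exprn_ege1// (le_trans ler01 C1).
  rewrite leNgt; apply/negP => lt_k; apply: no_loops; exists k, s; split => //.
  apply: le_lt_trans lt_k; rewrite ler_peMl// exprn_ge0// (le_trans ler01 lam1)//.
pose D : R := #|V|%:R * #|A|%:R * C.
have D1 : 1 <= D by rewrite /D -natrM mulr_ege1// ler1n muln_gt0 V0.
have th0 : 0 < entropy R X - ln lam by rewrite subr_gt0.
have [n n_gt0 ltn] := poly_lt_expR #|V| th0 D1.
have lam0 : 0 < lam by exact: lt_le_trans lam1.
have nR : (0 : R) < n%:R by rewrite ltr0n.
have : expR (n%:R * entropy R X) <= #|words X n|%:R.
  rewrite -[leRHS]lnK ?posrE ?ltr0n ?card_words_gt0// ler_expR mulrC.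
  by rewrite -ler_pdivlMr//; exact: (entropyP R X0).2.
apply/negP; rewrite -ltNge.
have words_le : (#|words X n| <= size (cover ini ter L #|V| n))%N.
  rewrite cardE -(size_map val); apply: uniq_leq_size.
    by rewrite map_inj_uniq ?enum_uniq//; exact: val_inj.
  by move=> _ /mapP[w + ->]; rewrite mem_enum => /words_cover.
rewrite -(ler_nat R) in words_le; apply: (le_lt_trans words_le).
apply: (le_lt_trans (size_cover _ _ V0 A0 lam1 C1 loopsC)).
rewrite -(ltr_pM2r (exprn_gt0 n lam0)) in ltn; apply: (lt_le_trans ltn).
by rewrite -[X in X ^+ n](lnK lam0) -expRM_natl -expRD -mulrDr subrK.
Qed.

(** * Concatenations of blocks *)

(** Quotient and remainder of the division by d; the remainder is a natural
    number. *)
Definition quo (d : nat) (i : int) : int := (i %/ d%:Z)%Z.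

Definition rmd (d : nat) (i : int) : nat := absz (i %% d%:Z)%Z.

Lemma quo_eq d q r : (r < d)%N -> quo d (q * d%:Z + r%:Z) = q.
Proof.
by move=> rd; rewrite /quo divzMDl ?divz_small ?addr0//; lia.
Qed.

Lemma rmd_eq d q r : (r < d)%N -> rmd d (q * d%:Z + r%:Z) = r.
Proof. by move=> rd; rewrite /rmd modzMDl modz_small//= ltz_nat. Qed.

Lemma quo_rmdP d i : (0 < d)%N ->
  exists q r, (r < d)%N /\ i = q * d%:Z + r%:Z.
Proof.
move=> d0; exists (quo d i), (rmd d i).
have d0' : (0 : int) < d%:Z by rewrite ltz_nat.
split; last by rewrite /rmd gez0_abs ?modz_ge0 ?lt0r_neq0//; exact: divz_eq.
by rewrite -ltz_nat /rmd gez0_abs ?modz_ge0 ?lt0r_neq0// ltz_pmod.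
Qed.

Lemma quo_rmd_uniq d q r q' r' : (r < d)%N -> (r' < d)%N ->
  q * d%:Z + r%:Z = q' * d%:Z + r'%:Z -> q = q' /\ r = r'.
Proof.
move=> rd rd' qr; split.
  by rewrite -(quo_eq q rd) qr quo_eq.
by rewrite -(rmd_eq q rd) qr rmd_eq.
Qed.

Section Concat.
Variables (A : Type) (n : nat).
Hypothesis n0 : (0 < n)%N.

(** The sequence whose letters at places q n, .., q n + n - 1 are those of
    [B q]. *)
Definition concat (B : int -> n.-tuple A) : int -> A :=
  fun i => tnth (B (quo n i)) (Ordinal (ltn_pmod (rmd n i) n0)).

Lemma concatE B q (r : 'I_n) : concat B (q * n%:Z + r%:Z) = tnth (B q) r.
Proof.
rewrite /concat quo_eq//; congr tnth; apply: val_inj => /=.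
by rewrite rmd_eq// modn_small.
Qed.

End Concat.

Lemma window_concat (A : finType) n (n0 : (0 < n)%N) (B : int -> n.-tuple A) q :
  window (concat n0 B) (q * n%:Z) n = B q.
Proof. by apply: eq_from_tnth => k; rewrite tnth_window concatE. Qed.

(** * Recoding behind a marker *)

Section Marker.
Variables (A : finType) (n l : nat) (a b : n.-tuple A).
Hypothesis n0 : (0 < n)%N.

(** The word a a b, of length 3 n, occurs in [x] and ends just before place
    [j]. *)
Definition marker (x : int -> A) (j : int) : bool :=
  [&& window x (j - n%:Z - n%:Z - n%:Z) n == a, window x (j - n%:Z - n%:Z) n == a
    & window x (j - n%:Z) n == b].

Lemma markerP x j : reflect (forall k : 'I_n,
   [/\ x (j - n%:Z - n%:Z - n%:Z + k%:Z) = tnth a k,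
       x (j - n%:Z - n%:Z + k%:Z) = tnth a k & x (j - n%:Z + k%:Z) = tnth b k])
  (marker x j).
Proof.
apply: (iffP and3P) => [[/eqP wa /eqP wa' /eqP wb] k|mk].
  by rewrite -!tnth_window wa wa' wb.
by split; apply/eqP/eq_from_tnth => k; rewrite tnth_window; have [] := mk k.
Qed.

Lemma marker_local x y j :
  (forall k : int, j - (3 * n)%:Z <= k -> k < j -> x k = y k) ->
  marker x j = marker y j.
Proof.
move=> xy.
have w d : d + n%:Z <= j -> j - (3 * n)%:Z <= d -> window x d n = window y d n.
  move=> dj jd; apply: eq_from_tnth => k; rewrite !tnth_window; apply: xy.
    by apply: le_trans jd _; rewrite lerDl.
  by apply: lt_le_trans dj; rewrite ltrD2l ltz_nat.
by rewrite /marker !w//; lia.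
Qed.

(** From the beginning of a marker, x_t = x_(t+n) holds up to the first place
    where the second a differs from b, and fails there.  Two distinct markers at
    distance at most n would disagree on the place of this failure. *)
Lemma marker_sep x j d : a <> b -> (0 < d <= n)%N ->
  marker x j -> marker x (j + d%:Z) -> False.
Proof.
move=> ab dn mj mj'.
have /existsP[f0 abf0] : [exists f : 'I_n, tnth a f != tnth b f].
  rewrite -negb_forall; apply/negP => /forallP abE; apply: ab.
  by apply: eq_from_tnth => k; exact/eqP.
case: (@arg_minnP _ f0 (fun f => tnth a f != tnth b f) (@nat_of_ord n) abf0) => f abf f_min {f0 abf0}.
have per j' s : marker x j' -> (s < n + f)%N ->
    x (j' - n%:Z - n%:Z - n%:Z + s%:Z) = x (j' - n%:Z - n%:Z + s%:Z).
  move=> /markerP mk sf; have [sn|ns] := ltnP s n.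
    by have [-> ->] := mk (Ordinal sn).
  have kn : (s - n < n)%N by have := ltn_ord f; lia.
  have [_] := mk (Ordinal kn); rewrite /=.
  have -> : j' - n%:Z - n%:Z + (s - n)%N%:Z = j' - n%:Z - n%:Z - n%:Z + s%:Z by lia.
  have -> : j' - n%:Z + (s - n)%N%:Z = j' - n%:Z - n%:Z + s%:Z by lia.
  move=> -> ->; apply/eqP; apply: contraT => /f_min /=; lia.
have := per _ (n + f - d)%N mj'.
have -> : j + d%:Z - n%:Z - n%:Z - n%:Z + (n + f - d)%N%:Z = j - n%:Z - n%:Z + f%:Z by lia.
have -> : j + d%:Z - n%:Z - n%:Z + (n + f - d)%N%:Z = j - n%:Z + f%:Z by lia.
have /markerP/(_ f)[_ -> ->] := mj.
by move=> abE; move: abf; rewrite abE ?eqxx//; lia.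
Qed.

(** A recoded letter: the original letter, unless erased, and possibly a word of
    length n. *)
Definition code_alphabet : finType := (option A * option (n.-tuple A))%type.

(** Behind each marker, l n letters are erased, and the words of length n
    starting at the l multiples of n (counted from the end of the marker) are
    written down.  [recode_rule] is the recoding at place 0. *)
Definition recode_rule (x : int -> A) : code_alphabet :=
  (if [exists t : 'I_(l * n), marker x (- t%:Z)] then None else Some (x 0),
   if [exists t : 'I_l, marker x (- (t * n)%N%:Z)] then Some (window x 0 n)
   else None).

Definition recode : (int -> A) -> (int -> code_alphabet) := code_of recode_rule.

Lemma marker_shift (x : int -> A) i j : marker (fun k => x (i + k)) j = marker x (i + j).
Proof.
have w d : window (fun k => x (i + k)) d n = window x (i + d) n.
  by apply: eq_from_tnth => k; rewrite !tnth_window addrA.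
by rewrite /marker !w !addrA.
Qed.

Lemma recodeE x i : recode x i =
  (if [exists t : 'I_(l * n), marker x (i - t%:Z)] then None else Some (x i),
   if [exists t : 'I_l, marker x (i - (t * n)%N%:Z)] then Some (window x i n)
   else None).
Proof.
rewrite /recode /code_of /recode_rule addr0; congr (_, _).
  by under eq_existsb => t do rewrite marker_shift.
under eq_existsb => t do rewrite marker_shift.
by case: ifP.
Qed.

Lemma recode_rule_local : local_rule recode_rule ((l + 3) * n).
Proof.
move=> x y xy; rewrite /recode_rule.
have mk (t : nat) : (t <= l * n)%N -> marker x (- t%:Z) = marker y (- t%:Z).
  move=> tl; apply: marker_local => k k1 k2; apply: xy.
  by rewrite mulnDl; lia.
congr (_, _).
  rewrite xy//; congr (if _ then _ else _).
  by apply: eq_existsb => t; apply: mk; exact: ltnW.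
have -> : window x 0 n = window y 0 n.
  apply: eq_from_tnth => k; rewrite !tnth_window; apply: xy.
  by rewrite add0r /= mulnDl; have := ltn_ord k; lia.
congr (if _ then _ else _).
by apply: eq_existsb => t; apply: mk; rewrite leq_mul2r ltnW ?orbT.
Qed.

(** A letter not erased is visible, and an erased one belongs to one of the
    words written down.  No hypothesis on the markers is needed. *)
Lemma recode_inj : injective recode.
Proof.
move=> x y xy; apply/funext => i.
have := congr1 (fun z => z i) xy; rewrite !recodeE => -[+ _].
case: ifP => [/existsP[t mk]|_]; last by case: ifP => // _ [].
move=> _.
have tl : (t %/ n < l)%N by rewrite ltn_divLR.
pose j := i - (t %% n)%N%:Z.
have mkj : marker x (j - (t %/ n * n)%N%:Z).
  by have <- : i - t%:Z = j - (t %/ n * n)%N%:Z by rewrite /j {1}(divn_eq t n); lia.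
have := congr1 (fun z => z j) xy; rewrite !recodeE => -[_].
case: ifP => [_|/existsP[]]; last by exists (Ordinal tl).
case: ifP => // _ /(congr1 (odflt a)) wE.
have := congr1 (fun w => tnth w (Ordinal (ltn_pmod t n0))) wE.
by rewrite !tnth_window /= /j subrK.
Qed.

(** The cyclic rotation of [a] by m places. *)
Definition rotation (m : nat) : n.-tuple A :=
  [tuple tnth a (Ordinal (ltn_pmod (k + m) n0)) | k < n].

Definition rotations : {set n.-tuple A} := [set rotation m | m : 'I_n]%SET.

Lemma card_rotations : (#|rotations| <= n)%N.
Proof. by rewrite -[leqRHS]card_ord; exact: leq_imset_card. Qed.

Lemma rotation0 : rotation 0 = a.
Proof.
apply: eq_from_tnth => k; rewrite tnth_mktuple; congr tnth; apply: val_inj.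
by rewrite /= addn0 modn_small.
Qed.

Lemma mem_rotations m : (m < n)%N -> rotation m \in rotations.
Proof. by move=> mn; apply/imsetP; exists (Ordinal mn). Qed.

(** * Recoding of framed concatenations *)

Variable W : {set n.-tuple A}.
Hypotheses (bW : b \in W) (W_rot : forall w, w \in W -> w \notin rotations).

Lemma a_notin_W : a \notin W.
Proof.
by apply/negP => /W_rot; rewrite -{1}rotation0 mem_rotations.
Qed.

(** Number of blocks in a period  a a b w_1 .. w_l. *)
Definition period := (l + 3)%N.

(** The blocks [B] follow the pattern  a a b w_1 .. w_l  with all w_i in [W]. *)
Definition framed (B : int -> n.-tuple A) : Prop := forall q s, (s < period)%N ->
  if (s < 2)%N then B (q * period%:Z + s%:Z) = a
  else if s == 2 then B (q * period%:Z + s%:Z) = b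
  else B (q * period%:Z + s%:Z) \in W.

(** A block is the first or the second block a of its period, or is in [W]
    (which contains b). *)
Lemma framed_a_or_W B q : framed B ->
  (exists Q, [/\ q = Q * period%:Z, B q = a, B (q + 1) = a & B (q + 2) = b]) \/
  (exists Q, [/\ q = Q * period%:Z + 1 & B q = a]) \/
  B q \in W.
Proof.
move=> fB; have [Q [s [sP ->]]] := @quo_rmdP period q (leq_trans (ltn0Sn 2) (leq_addl l 3)).
have := fB Q s sP.
case: s sP => [|[|[|s]]] sP //=.
- move=> Ba; left; exists Q; rewrite addr0 in Ba *; split => //.
    by apply: (fB Q 1%N); rewrite /period; lia.
  by apply: (fB Q 2%N); rewrite /period; lia.
- by move=> Ba; right; left; exists Q.
- by move=> ->; right; right.
- by move=> Bw; right; right.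
Qed.

Lemma marker_frame B Q : framed B ->
  marker (concat n0 B) ((Q * period%:Z + 3) * n%:Z).
Proof.
move=> fB; rewrite /marker.
have E1 : (Q * period%:Z + 3) * n%:Z - n%:Z = (Q * period%:Z + 2) * n%:Z by ring.
have E2 : (Q * period%:Z + 2) * n%:Z - n%:Z = (Q * period%:Z + 1) * n%:Z by ring.
have E3 : (Q * period%:Z + 1) * n%:Z - n%:Z = (Q * period%:Z + 0) * n%:Z by ring.
rewrite E1 E2 E3 !window_concat.
by rewrite (fB Q 0%N) ?(fB Q 1%N) ?(fB Q 2%N) ?eqxx// /period; lia.
Qed.

(** The converse of [marker_frame]: in a framed concatenation there are no other
    markers. *)
Lemma marker_concat B j : framed B -> marker (concat n0 B) j ->
  exists Q, j = (Q * period%:Z + 3) * n%:Z.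
Proof.
move=> fB mj.
have aW := a_notin_W.
have ab : a <> b by move=> ab; move: aW; rewrite ab bW.
have [q [r [rn jq]]] := quo_rmdP (j - n%:Z - n%:Z - n%:Z) n0.
have [r0|r_gt0] := posnP r.
  move: jq; rewrite r0 addr0 => jq.
  have wj : B q = a /\ B (q + 1) = a.
    have /and3P[/eqP w1 /eqP w2 _] := mj.
    rewrite jq window_concat in w1.
    have : j - n%:Z - n%:Z = (q + 1) * n%:Z by rewrite mulrDl mul1r -jq; lia.
    by move=> E; rewrite E window_concat in w2.
  have [[Q [qQ _ _ _]]|[[Q [qQ _]]|]] := framed_a_or_W q fB.
  - exists Q; rewrite -qQ mulrDl -jq; lia.
  - have := fB Q 2%N; rewrite /= /period => /(_ (leq_addl l 3)).
    have -> : Q * (l + 3)%:Z + 2 = q + 1 by rewrite qQ /period; lia.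
    by rewrite wj.2.
  - by rewrite wj.1 (negbTE aW).
(* The aligned block q + 1 lies inside the word aa of the marker. *)
have Bq1 : B (q + 1) = rotation (n - r).
  apply: eq_from_tnth => k; rewrite -(concatE n0) tnth_mktuple.
  have -> : (q + 1) * n%:Z + k%:Z = j - n%:Z - n%:Z - n%:Z + (n - r + k)%N%:Z.
    by rewrite jq mulrDl; lia.
  have [kr|rk] := ltnP (n - r + k) n.
    have /markerP/(_ (Ordinal kr))[-> _ _] := mj.
    by congr tnth; apply: val_inj; rewrite /= addnC modn_small// addnC.
  have kn : (k - r < n)%N by have := ltn_ord k; lia.
  have /markerP/(_ (Ordinal kn))[_ + _] := mj; rewrite /=.
  have -> : j - n%:Z - n%:Z + (k - r)%N%:Z = j - n%:Z - n%:Z - n%:Z + (n - r + k)%N%:Z by lia.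
  move=> ->; congr tnth; apply: val_inj => /=.
  by rewrite (_ : (k + (n - r) = k - r + n)%N) ?modnDr ?modn_small//; lia.
have rot1 : B (q + 1) \in rotations by rewrite Bq1 mem_rotations// ltn_subrL r_gt0.
(* Hence the block q + 1 belongs to an aligned marker, less than n places away. *)
exfalso.
have [[Q [qQ _ _ _]]|[[Q [qQ _]]|BW]] := framed_a_or_W (q + 1) fB.
- have jE : (Q * period%:Z + 3) * n%:Z = j + (n - r)%N%:Z.
    by rewrite -qQ mulrDl mulrDl; lia.
  have := marker_frame Q fB; rewrite jE.
  by apply: marker_sep ab _ mj; lia.
- have jE : j = (Q * period%:Z + 3) * n%:Z + r%:Z.
    have -> : Q * period%:Z + 3 = q + 3 by lia.
    by rewrite mulrDl; lia.
  have := mj; rewrite jE.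
  by apply: marker_sep ab _ (marker_frame Q fB); lia.
- by have := W_rot BW; rewrite rot1.
Qed.

Lemma recode_concat B Q s (r : 'I_n) : framed B -> (s < period)%N ->
  recode (concat n0 B) ((Q * period%:Z + s%:Z) * n%:Z + r%:Z) =
  (if (3 <= s)%N then None else Some (tnth (B (Q * period%:Z + s%:Z)) r),
   if (3 <= s)%N && (r == 0 :> nat) then Some (B (Q * period%:Z + s%:Z)) else None).
Proof.
move=> fB sP; rewrite recodeE concatE.
set i := (Q * _ + _) * _ + _.
(* A marker ending t < l n places before i forces s >= 3 and t = r modulo n;
   conversely, if s >= 3, one ends (s - 3) n + r places before i. *)
have ends t : (t < l * n)%N -> marker (concat n0 B) (i - t%:Z) ->
    (3 <= s)%N /\ (t %% n = r)%N.
  move=> tl /(marker_concat fB)[Q' tE].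
  have tln : (t %/ n < l)%N by rewrite ltn_divLR.
  have : (Q * period%:Z + s%:Z) * n%:Z + r%:Z =
      (Q' * period%:Z + (t %/ n + 3)%N%:Z) * n%:Z + (t %% n)%N%:Z.
    apply: (addIr (- t%:Z)); rewrite -/i tE {3}(divn_eq t n).
    by rewrite !PoszD !PoszM; ring.
  move=> /(quo_rmd_uniq (ltn_ord r) (ltn_pmod t n0))[/(quo_rmd_uniq sP) + ->].
  by rewrite /period ltn_add2r => /(_ tln)[_ ->]; rewrite leq_addl.
have begins : (3 <= s)%N ->
    marker (concat n0 B) (i - ((s - 3) * n + r)%N%:Z).
  move=> s3; have := marker_frame Q fB.
  have -> : (Q * period%:Z + 3) * n%:Z = i - ((s - 3) * n + r)%N%:Z => //.
  rewrite /i; have -> : s%:Z = (s - 3)%N%:Z + 3 by lia.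
  by rewrite PoszD PoszM; ring.
have s3l : (3 <= s)%N -> (s - 3 < l)%N by move: sP; rewrite /period; lia.
congr (_, _).
  have -> // : [exists t : 'I_(l * n), marker (concat n0 B) (i - t%:Z)] = (3 <= s)%N.
  apply/existsP/idP => [[t /(ends _ (ltn_ord t))[]//]|s3].
  have tl : ((s - 3) * n + r < l * n)%N.
    by apply: (@leq_trans ((s - 3).+1 * n)); [rewrite mulSnr ltn_add2l|rewrite leq_mul2r s3l ?orbT].
  by exists (Ordinal tl); exact: begins.
have -> : [exists t : 'I_l, marker (concat n0 B) (i - (t * n)%N%:Z)] =
    (3 <= s)%N && (r == 0 :> nat).
  apply/existsP/andP => [[t mk]|[s3 /eqP r0]].
    have [|s3] := ends _ _ mk; first by rewrite ltn_pmul2r.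
    by rewrite modnMl => <-.
  by exists (Ordinal (s3l s3)); have := begins s3; rewrite r0 addn0.
case: ifP => // /andP[_ /eqP r0].
by rewrite /i r0 addr0 window_concat.
Qed.

(** The recoded letters offered at place r of the block number s of a period. *)
Definition choices (s r : nat) : {set code_alphabet} :=
  if (s < 3)%N then
    [set (Some (tnth (if (s < 2)%N then a else b) (Ordinal (ltn_pmod r n0))), None)]%SET
  else if r == 0 then [set (None, Some w) | w in W]%SET
  else [set (None, None)]%SET.

Lemma choices_neq0 s r : choices s r != finset.set0.
Proof.
rewrite /choices; case: ifP => _; last case: ifP => _.
- by apply/set0Pn; eexists; rewrite inE.
- by apply/set0Pn; exists (None, Some b); apply/imsetP; exists b.
- by apply/set0Pn; eexists; rewrite inE.
Qed.

(** The multi-choice point that offers all recoded framed concatenations. *)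
Definition choice_frame (i : int) : hat code_alphabet :=
  exist _ (choices (rmd period (quo n i)) (rmd n i)) (choices_neq0 _ _).

Lemma choice_frameE Q s r : (s < period)%N -> (r < n)%N ->
  val (choice_frame ((Q * period%:Z + s%:Z) * n%:Z + r%:Z)) = choices s r.
Proof. by move=> sP rn; rewrite /= quo_eq// !rmd_eq. Qed.

(** The choices are independent: whatever words of [W] are picked, the result is
    the recoding of the framed concatenation with these words. *)
Lemma choice_frame_sub (X : set (int -> A)) :
  (forall B, framed B -> X (concat n0 B)) ->
  multi_choice (recode @` X) choice_frame.
Proof.
move=> XB y y_choice.
pose B (q : int) : n.-tuple A := let s := rmd period q in
  if (s < 2)%N then a else if s == 2 then b else odflt b (y (q * n%:Z)).2.
have BE Q s : (s < period)%N -> B (Q * period%:Z + s%:Z) =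
    if (s < 2)%N then a else if s == 2 then b
    else odflt b (y ((Q * period%:Z + s%:Z) * n%:Z)).2.
  by move=> sP; rewrite /B rmd_eq.
have yE Q s r : (s < period)%N -> (r < n)%N ->
    y ((Q * period%:Z + s%:Z) * n%:Z + r%:Z) \in choices s r.
  by move=> sP rn; rewrite -(choice_frameE Q)//; exact: y_choice.
have fB : framed B.
  move=> Q s sP; rewrite BE//; have := yE Q s 0%N sP n0; rewrite addr0.
  case: s sP => [|[|[|s]]] sP //=.
  by rewrite /choices /= => /imsetP[w wW ->].
exists (concat n0 B); first exact: XB.
apply/funext => i.
have [q [r [rn ->]]] := quo_rmdP i n0.
have [Q [s [sP ->]]] := @quo_rmdP period q (leq_trans (ltn0Sn 2) (leq_addl l 3)).
rewrite (recode_concat Q (Ordinal rn) fB sP) BE//.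
have := yE Q s r sP rn.
case: s sP => [|[|[|s]]] sP; rewrite /choices /=.
1-3: rewrite inE => /eqP ->; congr (Some (tnth _ _), _); apply: val_inj => /=.
1-3: by rewrite modn_small.
case: ifPn => [/eqP ->|_]; last by rewrite inE => /eqP.
by rewrite addr0 => /imsetP[w wW ->].
Qed.

(** Each of the first m periods contains l places with #|W| choices. *)
Lemma max_choice_recode (R : realType) (X : set (int -> A)) m :
  (forall B, framed B -> X (concat n0 B)) ->
  m%:R * (l%:R * ln #|W|%:R) <= max_choice R (recode @` X) (m * (period * n)).
Proof.
move=> XB.
have w_words : window choice_frame 0 (m * (period * n)) \in
    words (multi_choice (recode @` X)) (m * (period * n)).
  by apply/wordsP; exists choice_frame; [exact: choice_frame_sub | exists 0].
apply: le_trans (le_bigmax_cond _ _ w_words).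
rewrite ln_card_choice_words.
pose F (k : nat) : R := ln #|val (choice_frame k%:Z)|%:R.
rewrite (eq_bigr (fun k : 'I_(m * (period * n)) => F k)); last first.
  by move=> k _; rewrite tnth_window add0r.
have F_ge0 k : 0 <= F k by exact: ln_nat_ge0.
have Fblock Q s : (s < period)%N -> (3 <= s)%N ->
    F ((Q * period + s) * n)%N = ln #|W|%:R.
  move=> sP s3; rewrite /F.
  have -> : ((Q * period + s) * n)%N%:Z = (Q%:Z * period%:Z + s%:Z) * n%:Z + 0%N%:Z.
    by rewrite addr0 PoszM PoszD PoszM.
  rewrite choice_frameE// /choices ltnNge s3 /= card_imset//.
  by move=> u v [].
rewrite -(big_mkord xpredT F) mulnA big_nat_mul.
pose H q := F (q * n)%N.
apply: (@le_trans _ _ (\sum_(0 <= q < m * period) H q)); last first.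
  apply: ler_sum => q _; rewrite big_ltn ?ltn_pmul2r//= lerDl.
  by apply: sumr_ge0 => k _; exact: F_ge0.
rewrite big_nat_mul mulr_natl -[m in leLHS]subn0 -sumr_const_nat.
apply: ler_sum => Q _.
rewrite -[X in index_iota X _]add0n big_addn mulSn addnK.
rewrite (@big_cat_nat _ _ _ 3)//=; last by rewrite /period leq_addl.
rewrite -[leLHS]add0r; apply: lerD.
  by apply: sumr_ge0 => k _; exact: F_ge0.
have -> : l = (period - 3)%N by rewrite /period addnK.
rewrite mulr_natl -sumr_const_nat [leLHS]big_nat [leRHS]big_nat.
by apply: ler_sum => s /andP[s3 sP]; rewrite /H addnC Fblock.
Qed.

Lemma ind_entropy_recode (R : realType) (X : set (int -> A)) :
  (forall B, framed B -> X (concat n0 B)) ->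
  l%:R * ln #|W|%:R / (period * n)%:R <= ind_entropy R (recode @` X).
Proof.
move=> XB; set c := l%:R * _; set N := (period * n)%N.
have N0 : (0 < N)%N by rewrite muln_gt0 n0 andbT /period addnS.
have [cvg_u _] := ind_entropyP R (recode @` X).
rewrite leNgt; apply/negP => lt_c.
have e0 : 0 < c / N%:R - ind_entropy R (recode @` X) by rewrite subr_gt0.
have /cvgrPdist_lt/(_ _ e0)[M _ /(_ (M.+1 * N)%N)] := cvg_u.
rewrite /= (leq_trans (leqnSn M) (leq_pmulr _ N0)) => /(_ isT).
rewrite -/(ind_entropy R _) ltr_distlC => /andP[_].
apply/negP; rewrite -leNgt addrC subrK ler_pdivlMr ?ltr0n ?muln_gt0//.
rewrite natrM mulrCA divfK ?pnatr_eq0 -?lt0n//.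
  exact: max_choice_recode.
by rewrite n0 /period addnS.
Qed.

End Marker.

(** * Both bounds *)

Section LoopConcat.
Variables (A V E : finType) (ini ter : E -> V) (L : E -> A).

Lemma walk_nth s p t e0 : walk ini ter s p t -> (0 < size p)%N ->
  [/\ ini (nth e0 p 0) = s, ter (nth e0 p (size p).-1) = t &
    forall k, (k.+1 < size p)%N -> ter (nth e0 p k) = ini (nth e0 p k.+1)].
Proof.
elim: p s => [//|e [|e' p] IH] s /andP[/eqP es wp] _.
  by split => //=; exact/eqP.
have [ie te' step] := IH _ wp isT.
by split => // -[|k] kp; [rewrite ie | exact: step].
Qed.

(** Loops at the same vertex may be concatenated freely. *)
Lemma concat_loops s n (n0 : (0 < n)%N) (B : int -> n.-tuple A) :
  (forall q, B q \in loops ini ter L s n) ->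
  ((fun xi : int -> E => L \o xi) @` edge_shift ini ter) (concat n0 B).
Proof.
move=> Bs.
have p_ex q : exists p, walk ini ter s p s /\ map L p = B q.
  by have := Bs q; rewrite inE => /asboolP[p]; exists p.
have [p pP] := choice p_ex.
have size_p q : size (p q) = n by rewrite -(size_map L) (pP q).2 size_tuple.
have [e0 _] : exists e0 : E, True.
  by move: (size_p 0) n0; case: (p 0) => [<-//|e0 _ _ _]; exists e0.
pose xi i := nth e0 (p (quo n i)) (rmd n i).
have xiE q r : (r < n)%N -> xi (q * n%:Z + r%:Z) = nth e0 (p q) r.
  by move=> rn; rewrite /xi quo_eq// rmd_eq.
exists xi.
  move=> i; have [q [r [rn ->]]] := quo_rmdP i n0.
  have pn q' : (0 < size (p q'))%N by rewrite size_p.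
  have [ip tp step] := walk_nth e0 (pP q).1 (pn q).
  rewrite xiE//; have [rn1|nr] := ltnP r.+1 n.
    have -> : q * n%:Z + r%:Z + 1 = q * n%:Z + r.+1%:Z by lia.
    by rewrite xiE// step// size_p.
  have rE : r = (size (p q)).-1 by rewrite size_p; lia.
  have -> : q * n%:Z + r%:Z + 1 = (q + 1) * n%:Z + 0%N%:Z.
    by rewrite mulrDl rE size_p; lia.
  rewrite xiE// rE tp.
  by have [-> _ _] := walk_nth e0 (pP (q + 1)).1 (pn _).
apply/funext => i /=; have [q [r [rn ->]]] := quo_rmdP i n0.
rewrite xiE// (concatE n0 B q (Ordinal rn)) (tnth_nth (L e0)) -(pP q).2.
by rewrite (nth_map e0)// size_p.
Qed.

End LoopConcat.

(** The bound on n ensures 1 + n <= expR (n * d). *)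
Lemma expR_ge_add (R : realType) (s d : R) n : 0 <= s -> 0 < d -> 4 / d ^+ 2 <= n%:R ->
  n%:R + expR (n%:R * s) <= expR (n%:R * (s + d)).
Proof.
move=> s0 d0 dn; set N : R := n%:R.
have N0 : 0 <= N by rewrite ler0n.
rewrite mulrDr expRD.
have e1 : 1 <= expR (N * s) by rewrite -expR0 ler_expR mulr_ge0.
have e2 : 1 + N <= expR (N * d).
  have -> : N * d = 2%:R * (N * d / 2) by field.
  rewrite expRM_natl.
  apply: (@le_trans _ _ ((1 + N * d / 2) ^+ 2)); last first.
    apply: lerXn2r; rewrite ?nnegrE ?expR_ge0 ?expR_ge1Dx//.
    by rewrite addr_ge0// divr_ge0// mulr_ge0// ltW.
  have N4 : 4 <= N * d ^+ 2 by rewrite -ler_pdivrMr ?exprn_gt0.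
  have NN : N * 4 <= N * (N * d ^+ 2) by rewrite ler_wpM2l.
  have Nd : 0 <= N * d by rewrite mulr_ge0// ltW.
  nra.
nra.
Qed.

(** With the loops and the recoding, any r below the entropy is reached. *)
Lemma exists_ind_entropy_ge (R : realType) (A : finType) (X : set (int -> A))
    (r : R) :
  sofic X -> 0 <= r -> r < entropy R X ->
  exists (B : finType) (Y : set (int -> B)),
    [/\ shift_space Y, conjugate X Y & r <= ind_entropy R Y].
Proof.
move=> [X_shift [V [E [ini [ter [L XE]]]]]] r0 rh.
have X0 : X !=set0 by have [] := X_shift.
(* A first d is lost when counting loops, a second one when removing rotations,
   and the third one to the markers. *)
pose d := (entropy R X - r) / 3.
have d0 : 0 < d by rewrite divr_gt0// subr_gt0.
have dE : entropy R X = r + d + d + d by rewrite /d; field.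
pose s := r + d.
have s0 : 0 <= s by rewrite addr_ge0// ltW.
have [n [v [nn0 lt_loops]]] : exists n v, ((Num.truncn (4 / d ^+ 2)).+1 <= n)%N /\
    expR (s + d) ^+ n < #|loops ini ter L v n|%:R.
  apply: loops_growth; rewrite -?XE//.
    by rewrite -expR0 ler_expR addr_ge0// ltW.
  by rewrite expRK dE /s ltrDl.
have n0 : (0 < n)%N by apply: leq_trans nn0.
have dn : 4 / d ^+ 2 <= n%:R.
  by apply: le_trans (ltW (truncnS_gt _)) _; rewrite ler_nat.
set S := loops ini ter L v n in lt_loops.
rewrite -expRM_natl in lt_loops.
have := le_lt_trans (expR_ge_add s0 d0 dn) lt_loops.
have [a aS] : exists a, a \in S.
  apply/card_gt0P; rewrite -(ltr0n R); apply: le_lt_trans lt_loops.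
  exact: expR_ge0.
pose W := (S :\: rotations a n0)%SET => SW.
have card_W : expR (n%:R * s) < #|W|%:R.
  have : (#|S| <= #|W| + n)%N.
    rewrite -(cardsID (rotations a n0) S) addnC leq_add2l.
    apply: leq_trans (subset_leq_card (subsetIr _ _)) (card_rotations _ _).
  rewrite -(ler_nat R) natrD; lra.
have W0 : (0 < #|W|)%N by rewrite -(ltr0n R) (le_lt_trans _ card_W)// expR_ge0.
have [b bW] : exists b, b \in W by exact/card_gt0P.
have W_rot w : w \in W -> w \notin rotations a n0 by rewrite inE => /andP[].
pose l := (Num.truncn (3 * r / d)).+1.
have lE : 3 * r <= l%:R * d by rewrite -ler_pdivrMr// ltW// truncnS_gt.
exists (code_alphabet A n), (recode l a b @` X); split.
- exact: (shift_space_code (@recode_rule_local A n l a b n0) X_shift).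
- exists (recode l a b); split.
    exact: (code_of_sliding X0 (@recode_rule_local A n l a b n0)).
  split; [by move=> x Xx; exists x| |by []].
  by move=> x y _ _; exact: recode_inj n0 _ _.
have XB B : framed l a b W B -> X (concat n0 B).
  move=> fB; rewrite XE; apply: (@concat_loops _ _ _ _ _ _ v) => q.
  have WS w : w \in W -> w \in S by rewrite inE => /andP[].
  have [[Q [_ -> _ _]]|[[Q [_ ->]]|/WS//]] := framed_a_or_W n0 bW q fB; exact: aS.
apply: le_trans (ind_entropy_recode bW W_rot R XB).
have P0 : (0 < period l * n)%N by rewrite muln_gt0 n0 andbT /period addnS.
rewrite ler_pdivlMr ?ltr0n//.
have lnW : n%:R * s <= ln #|W|%:R.
  by rewrite -ler_expR lnK ?posrE ?ltr0n// ltW.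
apply: (@le_trans _ _ (l%:R * (n%:R * s))); last by rewrite ler_wpM2l.
rewrite natrM [r * _]mulrA mulrC [leRHS]mulrCA ler_wpM2l// /period natrD /s.
lra.
Qed.

Lemma conjugate_refl (A : finType) (X : set (int -> A)) :
  X !=set0 -> conjugate X X.
Proof.
move=> X0; exists (code_of (fun x => x 0)).
have codeE : code_of (fun x : int -> A => x 0) = id.
  by apply/funext => x; apply/funext => i; rewrite /code_of addr0.
split; first by apply: (@code_of_sliding _ _ _ _ 0) => // x y ->.
by rewrite codeE; split => // x Xx; exists x.
Qed.

Theorem theorem1p1 (R : realType) (A : finType) (X : set (int -> A))
    (HX : sofic X) :
  sup_ind_entropy R X = (entropy R X)%:E.
Proof.
have X_shift : shift_space X by case: HX.
have X0 : X !=set0 by case: X_shift.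
apply/eqP; rewrite eq_le; apply/andP; split.
  apply: ge_ereal_sup => _ [B [Y [[Y0 _ _] XY ->]]].
  by rewrite lee_fin ind_entropy_le_factor.
apply/lee_subgt0Pr => e e0; rewrite -EFinB.
have [B [Y [Y_shift XY hY]]] : exists (B : finType) (Y : set (int -> B)),
    [/\ shift_space Y, conjugate X Y & entropy R X - e <= ind_entropy R Y].
  have [h0|h0] := leP 0 (entropy R X - e).
    by apply: exists_ind_entropy_ge => //; rewrite gtrBl.
  exists A, X; split => //; first exact: conjugate_refl.
  exact: le_trans (ltW h0) (ind_entropy_ge0 R X).
by apply: ereal_sup_ge; exists (ind_entropy R Y)%:E; [exists B, Y | rewrite lee_fin].
Qed.
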